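(* Let $m\ge 1$ be an odd integer, $i\ge 3$ and $n\ge 1$ integers. Then $$\overline{\mathrm{OPT}}_m\bigl(2^i n\bigr)\equiv\overline{\mathrm{OPT}}_m\bigl(2^{i-1}n\bigr)\pmod{2^{\,i+1}},$$ and moreover $$\nu\Bigl(\overline{\mathrm{OPT}}_m\bigl(2^i n\bigr)-\overline{\mathrm{OPT}}_m\bigl(2^{i-1}n\bigr)\Bigr)=i+1\quad\text{if } n \text{ is an odd square},$$ $$\nu\Bigl(\overline{\mathrm{OPT}}_m\bigl(2^i n\bigr)-\overline{\mathrm{OPT}}_m\bigl(2^{i-1}n\bigr)\Bigr)\ge i+2\quad\text{otherwise}.$$
   Context: An overpartition of $n$ is a partition of $n$ in which the first occurrence of each part may be overlined. For an integer $m\ge 1$, $\overline{\mathrm{OPT}}_m(n)$ denotes the number of overpartition $m$-tuples of $n$ into odd parts, i.e. $m$-tuples of overpartitions all of whose parts are odd and whose parts sum (over all components) to $n$. Equivalently, $$\sum_{n\ge 0}\overline{\mathrm{OPT}}_m(n)q^n=\prod_{j\ge 1,\ j\text{ odd}}\left(\frac{1+q^j}{1-q^j}\right)^m\in\mathbb{Z}[[q]].$$ $\nu$ denotes the $2$-adic valuation on $\mathbb{Z}$, with $\nu(0)=\infty$. *)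

(* Defs.v *)
From mathcomp Require Import all_boot all_order all_algebra.
From mathcomp Require Import constructive_ereal.

Set Implicit Arguments.
Unset Strict Implicit.
Unset Printing Implicit Defensive.

Import Order.TTheory GRing.Theory Num.Theory.

(* Overpartitions of size at most n.  The first component gives the number of
   occurrences of each part; the second is the set of the parts whose first
   occurrence is overlined.  Parts of an overpartition of size at most n, and
   their multiplicities, are at most n, so the ranges 'I_n.+1 lose nothing. *)
Definition overpart_data (n : nat) : finType :=
  ({ffun 'I_n.+1 -> 'I_n.+1} * {set 'I_n.+1})%type.

Definition mult (n : nat) (p : overpart_data n) (j : 'I_n.+1) : nat := p.1 j.

Definition overlined (n : nat) (p : overpart_data n) : {set 'I_n.+1} := p.2.

Definition is_part (n : nat) (p : overpart_data n) (j : 'I_n.+1) : bool :=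
  (0 < mult p j)%N.

Definition is_overpartition (n : nat) (p : overpart_data n) : bool :=
  [forall j, is_part p j ==> (0 < j)%N] &&
  [forall j in overlined p, is_part p j].

Definition odd_parts (n : nat) (p : overpart_data n) : bool :=
  [forall j, is_part p j ==> odd j].

Definition overpart_size (n : nat) (p : overpart_data n) : nat :=
  (\sum_(j < n.+1) mult p j * j)%N.

Definition OPT (m n : nat) : nat :=
  #|[set t : {ffun 'I_m -> overpart_data n} |
      [forall k, is_overpartition (t k) && odd_parts (t k)] &&
      (\sum_(k < m) overpart_size (t k) == n)%N]|.

(* logn 2 0 = 0, hence the separate case at 0. *)
Definition nu (z : int) : \bar int :=
  if z == 0%R then +oo%E else ((logn 2 `|z|%N)%:Z%:E)%E.

(* Main.v *)
(** Let [phi(q)] be the theta series of the squares and [P] the generating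
    series of the overpartitions into odd parts.  The Jacobi triple product gives
    [P(q)^2 = phi(q) / phi(-q)], and [r_2(2n) = r_2(n)] then yields the modular
    equations [P(q) P(-q) = 1] and [P(q)^2 + P(-q)^2 = 2 P(q^2)^4].  Let [U] keep
    the coefficients of even index, so that [OPT m (2^i n)] is the coefficient of
    index [n] in [U^i (P^m)].  Write [P^4 = 1 + 8x], [z = 4x], [g = U P] and
    [w = g P^2].  By the modular equations, [U (P^m) = g (1 + 4 z a)] for odd [m],
    and [U g = w], [U w = w (1 + 4z)], while [U] maps both [g z Z[z]] and
    [w z Z[z]] into [2 w z Z[z]], with [U (w z) = 2 w z] modulo [4 w z Z[z]].
    Hence [U^i (P^m) - U^(i-1) (P^m)] is [2^(i+1) w x (1 + 2b)] with [b] in [Z[z]],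
    for [i >= 3], and modulo 2 one has [w = 1] and [x = sum of q^(k^2), k odd]. *)

From HB Require Import structures.
Require Import Defs.
From mathcomp Require Import all_boot all_order all_algebra.
From mathcomp Require Import constructive_ereal.
From mathcomp Require Import boolp ring zify.

Set Implicit Arguments.
Unset Strict Implicit.
Unset Printing Implicit Defensive.

Import Order.TTheory GRing.Theory Num.Theory.

(** * Formal power series *)

Record fps (R : Type) := Fps { coefs : nat -> R }.

Section FpsRing.
Local Open Scope ring_scope.
Variable R : comNzRingType.
Implicit Types f g h : fps R.

Lemma fpsP f g : coefs f =1 coefs g -> f = g.
Proof. by case: f g => [f] [g] /= /funext ->. Qed.

HB.instance Definition _ := gen_eqMixin (fps R).
HB.instance Definition _ := gen_choiceMixin (fps R).

Definition fps_add f g := Fps (fun n => coefs f n + coefs g n).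
Definition fps_opp f := Fps (fun n => - coefs f n).
Definition fps_const c : fps R := Fps (fun n => if n is 0%N then c else 0).
Definition fps_mul f g := Fps (fun n => \sum_(i < n.+1) coefs f i * coefs g (n - i)).
Definition fps_trunc N f := \poly_(i < N.+1) coefs f i.

Fact fps_addA : associative fps_add.
Proof. by move=> f g h; apply: fpsP => n /=; rewrite addrA. Qed.
Fact fps_addC : commutative fps_add.
Proof. by move=> f g; apply: fpsP => n /=; rewrite addrC. Qed.
Fact fps_add0 : left_id (fps_const 0) fps_add.
Proof. by move=> f; apply: fpsP => -[|n] /=; rewrite add0r. Qed.
Fact fps_addN : left_inverse (fps_const 0) fps_opp fps_add.
Proof. by move=> f; apply: fpsP => -[|n] /=; rewrite addNr. Qed.

HB.instance Definition _ :=
  GRing.isZmodule.Build (fps R) fps_addA fps_addC fps_add0 fps_addN.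

Fact coef_fps_trunc N f n : (n <= N)%N -> (fps_trunc N f)`_n = coefs f n.
Proof. by rewrite -ltnS coef_poly => ->. Qed.

(** Up to order [N] a product is computed on polynomial truncations, so commutativity and
    associativity come from [{poly R}]. *)
Fact coefs_fps_mul N f g n : (n <= N)%N ->
  coefs (fps_mul f g) n = (fps_trunc N f * fps_trunc N g)`_n.
Proof.
move=> nN; rewrite coefM; apply: eq_bigr => -[i /=]; rewrite ltnS => le_in _.
by rewrite !coef_fps_trunc ?(leq_trans (leq_subr _ _)) // (leq_trans le_in).
Qed.

Fact fps_mulC : commutative fps_mul.
Proof. by move=> f g; apply: fpsP => n; rewrite !(coefs_fps_mul _ _ (leqnn n)) mulrC. Qed.

Fact fps_mulA : associative fps_mul.
Proof.
move=> f g h; apply: fpsP => n; rewrite !(coefs_fps_mul _ _ (leqnn n)).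
have trM u v k : (k <= n)%N ->
    (fps_trunc n (fps_mul u v))`_k = (fps_trunc n u * fps_trunc n v)`_k.
  by move=> kn; rewrite coef_fps_trunc // (coefs_fps_mul _ _ kn).
rewrite coefMr [RHS]coefM.
transitivity (fps_trunc n f * (fps_trunc n g * fps_trunc n h))`_n.
  by rewrite coefMr; apply: eq_bigr => i _; rewrite trM // -ltnS.
by rewrite mulrA coefM; apply: eq_bigr => i _; rewrite trM // -ltnS.
Qed.

Fact fps_mul1 : left_id (fps_const 1) fps_mul.
Proof.
move=> f; apply: fpsP => n /=; rewrite big_ord_recl /= subn0 mul1r.
by rewrite big1 ?addr0 // => i _; rewrite mul0r.
Qed.

Fact fps_mulDl : left_distributive fps_mul fps_add.
Proof.
move=> f g h; apply: fpsP => n /=; rewrite -big_split.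
by apply: eq_bigr => i _ /=; rewrite mulrDl.
Qed.

Fact fps_oner_neq0 : fps_const 1 != 0.
Proof. by apply/eqP => /(congr1 (@coefs R)) /(congr1 (@^~ 0%N)) /eqP; rewrite oner_eq0. Qed.

HB.instance Definition _ := GRing.Zmodule_isComNzRing.Build (fps R)
  fps_mulA fps_mulC fps_mul1 fps_mulDl fps_oner_neq0.

End FpsRing.

Section FpsTheory.
Local Open Scope ring_scope.
Variable R : comNzRingType.
Implicit Types (f g h : fps R) (k n N : nat).

Lemma coefsD f g n : coefs (f + g) n = coefs f n + coefs g n.
Proof. by []. Qed.

Lemma coefsN f n : coefs (- f) n = - coefs f n.
Proof. by []. Qed.

Lemma coefsM f g n : coefs (f * g) n = \sum_(i < n.+1) coefs f i * coefs g (n - i).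
Proof. by []. Qed.

Lemma coefs0 n : coefs (0 : fps R) n = 0.
Proof. by case: n. Qed.

Lemma coefs1 n : coefs (1 : fps R) n = (n == 0)%:R.
Proof. by case: n. Qed.

Lemma coefsMn f k n : coefs (f *+ k) n = coefs f n *+ k.
Proof. by elim: k => [|k IH]; rewrite ?mulr0n ?coefs0 // !mulrS coefsD IH. Qed.

Lemma coefs_sum (I : Type) (r : seq I) (Q : pred I) (F : I -> fps R) n :
  coefs (\sum_(i <- r | Q i) F i) n = \sum_(i <- r | Q i) coefs (F i) n.
Proof. by apply: (big_morph (fun f => coefs f n)) => [f g|]; rewrite ?coefs0. Qed.

Lemma coefsM0 f g : coefs (f * g) 0 = coefs f 0 * coefs g 0.
Proof. by rewrite coefsM big_ord1. Qed.

Lemma coefsX0 f k : coefs (f ^+ k) 0 = coefs f 0 ^+ k.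
Proof. by elim: k => [|k IH]; rewrite ?expr0 ?coefs1 // !exprS coefsM0 IH. Qed.

Definition fpsX : fps R := Fps (fun n => (n == 1)%:R).
Local Notation q := fpsX.

Lemma coefsXM f n : coefs (q * f) n = if n is k.+1 then coefs f k else 0.
Proof.
rewrite coefsM; case: n => [|n]; first by rewrite big_ord1 mul0r.
rewrite big_ord_recl mul0r add0r big_ord_recl mul1r subn1 big1 ?addr0 // => i _.
by rewrite mul0r.
Qed.

Lemma coefsXnM f k n : coefs (q ^+ k * f) n = if (n < k)%N then 0 else coefs f (n - k).
Proof.
elim: k n => [|k IH] n; first by rewrite mul1r subn0.
by rewrite exprS -mulrA coefsXM; case: n => [|n] //; rewrite IH.
Qed.

Lemma coefsXn k n : coefs (q ^+ k) n = (n == k)%:R.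
Proof. by rewrite -[q ^+ k]mulr1 coefsXnM coefs1; case: ltngtP => // nk; congr (_%:R); lia. Qed.

Lemma fpsX_reg k f g : q ^+ k * f = q ^+ k * g -> f = g.
Proof.
move=> e; apply: fpsP => n; move/(congr1 (fun u => coefs u (k + n))): e.
by rewrite !coefsXnM ltnNge leq_addr /= addKn.
Qed.

(** * Congruence modulo [q^N] *)

Definition eqmodX N f g := forall n, (n < N)%N -> coefs f n = coefs g n.

Lemma eqmodX_refl N f : eqmodX N f f.
Proof. by []. Qed.

Lemma eqmodX_sym N f g : eqmodX N f g -> eqmodX N g f.
Proof. by move=> e n nN; rewrite e. Qed.

Lemma eqmodX_trans N g f h : eqmodX N f g -> eqmodX N g h -> eqmodX N f h.
Proof. by move=> e e' n nN; rewrite e // e'. Qed.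

Lemma eqmodXW M N f g : (N <= M)%N -> eqmodX M f g -> eqmodX N f g.
Proof. by move=> NM e n nN; rewrite e // (leq_trans nN). Qed.

Lemma eqmodXD N f f' g g' : eqmodX N f f' -> eqmodX N g g' -> eqmodX N (f + g) (f' + g').
Proof. by move=> e e' n nN; rewrite !coefsD e // e'. Qed.

Lemma eqmodXM N f f' g g' : eqmodX N f f' -> eqmodX N g g' -> eqmodX N (f * g) (f' * g').
Proof.
move=> e e' n nN; rewrite !coefsM; apply: eq_bigr => -[i /=]; rewrite ltnS => le_in _.
by rewrite e ?e' // ?(leq_ltn_trans _ nN) // leq_subr.
Qed.

Lemma eqmodX_exp N f f' k : eqmodX N f f' -> eqmodX N (f ^+ k) (f' ^+ k).
Proof. by move=> e; elim: k => [|k IH] //; rewrite !exprS; apply: eqmodXM. Qed.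

Lemma eqmodX_sum N (I : Type) (r : seq I) (Q : pred I) (F G : I -> fps R) :
  (forall i, Q i -> eqmodX N (F i) (G i)) ->
  eqmodX N (\sum_(i <- r | Q i) F i) (\sum_(i <- r | Q i) G i).
Proof. by move=> e; apply: big_ind2 => // f f' g g'; apply: eqmodXD. Qed.

Lemma eqmodX_prod N (I : Type) (r : seq I) (Q : pred I) (F G : I -> fps R) :
  (forall i, Q i -> eqmodX N (F i) (G i)) ->
  eqmodX N (\prod_(i <- r | Q i) F i) (\prod_(i <- r | Q i) G i).
Proof. by move=> e; apply: big_ind2 => // f f' g g'; apply: eqmodXM. Qed.

Lemma eqmodX_Xn N k : (N <= k)%N -> eqmodX N (q ^+ k) 0.
Proof. by move=> Nk n nN; rewrite coefsXn coefs0; case: eqP => // nk; lia. Qed.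

Lemma eqmodX_eq f g : (forall N, eqmodX N f g) -> f = g.
Proof. by move=> e; apply: fpsP => n; apply: (e n.+1). Qed.

Lemma eqmodX_exp0 f k : coefs f 0 = 0 -> eqmodX k (f ^+ k) 0.
Proof.
move=> f0; elim: k => [|k IH] n //; rewrite ltnS => nk; rewrite exprS coefsM coefs0.
rewrite big_ord_recl f0 mul0r add0r big1 // => i _; rewrite IH ?coefs0 ?mulr0 //=.
by have := ltn_ord i; rewrite /bump /=; lia.
Qed.

(** The geometric series in [1 - f], cut at the last power that can reach the coefficient [n]. *)
Definition fps_inv f : fps R := Fps (fun n => coefs (\sum_(k < n.+1) (1 - f) ^+ k) n).

Lemma fps_mulV f : coefs f 0 = 1 -> f * fps_inv f = 1.
Proof.
move=> f0; have h0 : coefs (1 - f) 0 = 0 by rewrite coefsD coefsN coefs1 f0 subrr.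
apply: eqmodX_eq => N; have [->|N0] := posnP N; first by move=> n.
have e : eqmodX N (fps_inv f) (\sum_(k < N) (1 - f) ^+ k).
  move=> n nN; rewrite -(subnKC nN) big_split_ord /= [X in _ = _ + X]coefs_sum.
  rewrite [X in _ = _ + X]big1 ?addr0 // => k _; rewrite (eqmodX_exp0 h0) ?coefs0 //.
  by rewrite addSn ltnS leq_addr.
apply: eqmodX_trans (eqmodXM (eqmodX_refl f) e) _.
have -> : f * \sum_(k < N) (1 - f) ^+ k = 1 - (1 - f) ^+ N.
  by rewrite -[1 - _ ^+ N]opprB subrX1 -mulNr opprB opprB addrCA subrr addr0.
by move=> n nN; rewrite coefsD coefsN (eqmodX_exp0 h0) // coefs0 subr0.
Qed.

Lemma eqmodX_cancel N u f g : coefs u 0 = 1 -> eqmodX N (f * u) (g * u) -> eqmodX N f g.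
Proof.
move=> u0 e; have := eqmodXM e (eqmodX_refl (fps_inv u)).
by rewrite -!mulrA fps_mulV // !mulr1.
Qed.

(* f(-q), f(q^2), and the part of f of even exponents, written as a series in q^2. *)
Definition fps_neg f : fps R := Fps (fun n => (-1) ^+ n * coefs f n).
Definition fps_sq f : fps R := Fps (fun n => if odd n then 0 else coefs f n./2).
Definition fps_U f : fps R := Fps (fun n => coefs f n.*2).

Local Notation neg := fps_neg.
Local Notation sq := fps_sq.
Local Notation U := fps_U.

Lemma neg_is_additive : {morph neg : f g / f - g}.
Proof. by move=> f g; apply: fpsP => n /=; rewrite mulrBr. Qed.

Lemma neg_is_multiplicative : monoid_morphism neg.
Proof.
split; first by apply: fpsP => -[|n] /=; rewrite ?expr0 ?mulr1 ?mulr0.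
move=> f g; apply: fpsP => n /=; rewrite mulr_sumr.
apply: eq_bigr => -[i /=]; rewrite ltnS => le_in _.
by rewrite mulrACA -exprD subnKC.
Qed.

HB.instance Definition _ := GRing.isZmodMorphism.Build (fps R) (fps R) neg neg_is_additive.
HB.instance Definition _ := GRing.isMonoidMorphism.Build (fps R) (fps R) neg neg_is_multiplicative.

Lemma sum_even (F : nat -> R) n : (forall i, odd i -> F i = 0) ->
  \sum_(i < n.*2.+1) F i = \sum_(i < n.+1) F i.*2.
Proof.
move=> F0; elim: n => [|n IH]; first by rewrite !big_ord1.
rewrite doubleS big_ord_recr big_ord_recr /= IH [RHS]big_ord_recr /=.
by rewrite (F0 n.*2.+1) ?addr0 //= odd_double.
Qed.

(** The odd coefficients of [sq f] vanish, so [U] is linear over the series in q^2. This pulls every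
    factor in q^2 out of [U] below. *)
Lemma U_sqM f g : U (sq f * g) = f * U g.
Proof.
apply: fpsP => n; rewrite -[LHS]/(coefs (sq f * g) n.*2) coefsM.
rewrite (sum_even (F := fun i => coefs (sq f) i * coefs g (n.*2 - i))).
  by rewrite coefsM; apply: eq_bigr => i _ /=; rewrite odd_double doubleK doubleB.
by move=> i /= ->; rewrite mul0r.
Qed.

Lemma U_sq f : U (sq f) = f.
Proof. by apply: fpsP => n /=; rewrite odd_double doubleK. Qed.

Lemma sq_inj : injective sq.
Proof. exact: can_inj U_sq. Qed.

Lemma sq_is_additive : {morph sq : f g / f - g}.
Proof. by move=> f g; apply: fpsP => n /=; case: odd; rewrite ?subr0. Qed.

Lemma sq_is_multiplicative : monoid_morphism sq.
Proof.
split; first by apply: fpsP => -[|[|n]] //=; case: odd.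
move=> f g; apply: fpsP => n /=; case: ifP => [n_odd|n_even].
  rewrite big1 // => -[i /=]; rewrite ltnS => le_in _.
  by rewrite oddB // n_odd; case: odd; rewrite ?mul0r ?mulr0.
have -> : n = n./2.*2 by rewrite -[LHS]odd_double_half n_even.
by rewrite -[RHS]/(coefs (U (sq f * sq g)) n./2) U_sqM U_sq doubleK.
Qed.

HB.instance Definition _ := GRing.isZmodMorphism.Build (fps R) (fps R) sq sq_is_additive.
HB.instance Definition _ := GRing.isMonoidMorphism.Build (fps R) (fps R) sq sq_is_multiplicative.

Lemma U_is_additive : {morph U : f g / f - g}.
Proof. by move=> f g; apply: fpsP. Qed.
HB.instance Definition _ := GRing.isZmodMorphism.Build (fps R) (fps R) U U_is_additive.

Lemma neg_sq f : neg (sq f) = sq f.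
Proof. by apply: fpsP => n /=; rewrite -signr_odd; case: odd; rewrite ?mulr0 ?mul1r. Qed.

Lemma add_neg f : f + neg f = (sq (U f)) *+ 2.
Proof.
apply: fpsP => n; rewrite coefsMn /= -signr_odd.
case: ifP => n_odd; first by rewrite mulN1r subrr mul0rn.
by rewrite mul1r mulr2n; congr (coefs f _ + coefs f _); lia.
Qed.

Lemma U_neg f : U (neg f) = U f.
Proof. by apply: fpsP => n /=; rewrite -signr_odd odd_double mul1r. Qed.

Lemma coefs_iterU f i n : coefs (iter i U f) n = coefs f (2 ^ i * n).
Proof.
elim: i n => [|i IH] n; first by rewrite mul1n.
by rewrite /= IH; congr coefs; rewrite expnS -muln2; lia.
Qed.

End FpsTheory.

(** * Counting overpartition tuples *)

Section Counting.
Local Open Scope ring_scope.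
Variable n : nat.
Local Notation q := (fpsX int).

Definition odd_overpartition (p : overpart_data n) := is_overpartition p && odd_parts p.

Lemma odd_overpartitionE (f : {ffun 'I_n.+1 -> 'I_n.+1}) (S : {set 'I_n.+1}) :
  odd_overpartition (f, S) =
    [forall j, (0 < f j)%N ==> odd j] && (S \subset [set j | (0 < f j)%N]).
Proof.
rewrite /odd_overpartition /is_overpartition /odd_parts /is_part /mult /overlined /=.
apply/andP/andP => [[/andP[_ /forall_inP sub] od]|[od /subsetP sub]]; split=> //.
  by apply/subsetP => j /sub; rewrite inE.
apply/andP; split.
  by apply/forall_inP => j /(forall_inP od); case: (nat_of_ord j).
by apply/forall_inP => j /sub; rewrite inE.
Qed.

(* (1 + q^j) / (1 - q^j) up to the order n. *)
Definition odd_part_fps (j : nat) : fps int := 1 + (\sum_(c < n) q ^+ (c.+1 * j)) *+ 2.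

(** Expanding the product chooses a multiplicity for each odd part. Once these are fixed, the
    admissible overlinings are the subsets of the set of parts, whence a factor 2 for each part that
    occurs. *)
Lemma sum_odd_overpartition :
  \sum_(p : overpart_data n | odd_overpartition p) q ^+ overpart_size p =
  \prod_(j < n.+1 | odd j) odd_part_fps j.
Proof.
(* The weight of the part [j] taken [c] times: the boolean kills positive multiplicities of an even
   part, and the factor 2 appears only if [c > 0]. *)
pose w (j c : 'I_n.+1) : fps int :=
  (((0 < c)%N ==> odd j)%:R * q ^+ (c * j)) *+ 2 ^ (0 < c)%N.
rewrite big_mkcond -(pair_bigA _ (fun f S =>
  if odd_overpartition (f, S) then q ^+ overpart_size (f, S) else 0)) /=.
transitivity (\sum_(f : {ffun 'I_n.+1 -> 'I_n.+1}) \prod_j w j (f j)).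
  apply: eq_bigr => f _; rewrite -big_mkcond /=.
  under eq_bigl do rewrite odd_overpartitionE.
  rewrite /overpart_size /mult /=.
  have -> : \prod_j w j (f j) =
      ([forall j, (0 < f j)%N ==> odd j]%:R * q ^+ (\sum_j f j * j))
         *+ 2 ^ #|[set j | (0 < f j)%N]|.
    rewrite prodrMn -sum1_card -expn_sum big_split /= -expr_sum; congr (_ * _ *+ (2 ^ _)).
      case: (boolP [forall j, _]) => [/forallP v|/forallPn[j /negbTE nv]].
        by rewrite big1 // => j _; rewrite v.
      by rewrite (bigD1 j) //= nv mul0r.
    by rewrite [RHS]big_mkcond; apply: eq_bigr => j _; rewrite inE; case: ltnP.
  rewrite -card_powerset; case: [forall j, _]; last by rewrite mul0r mul0rn big_pred0.
  by rewrite mul1r sumr_const; congr (_ *+ _); apply: eq_card => S; rewrite powersetE.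
rewrite -(bigA_distr_bigA w) [RHS]big_mkcond; apply: eq_bigr => j _.
rewrite big_ord_recl /w /= mul0n expr0 mulr1.
under eq_bigr => c _ do rewrite /bump /= add1n.
rewrite mulr1n; case: (odd j).
  rewrite /odd_part_fps -sumrMnl.
  by under eq_bigr do rewrite mul1r.
by rewrite big1 ?addr0 // => c _; rewrite mul0r mul0rn.
Qed.

Lemma OPT_coefs m :
  (OPT m n)%:R = coefs ((\prod_(j < n.+1 | odd j) odd_part_fps j) ^+ m) n.
Proof.
rewrite -sum_odd_overpartition.
have -> : forall W : fps int, W ^+ m = \prod_(k < m) W.
  by move=> W; rewrite prodr_const card_ord.
under [X in coefs X]eq_bigr do rewrite big_mkcond.
rewrite bigA_distr_bigA coefs_sum.
rewrite /OPT -sum1_card natr_sum big_mkcond /=; apply: eq_bigr => t _.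
rewrite inE; case: ifP => [/andP[/forallP v /eqP s]|].
  under eq_bigr => k _ do rewrite [odd_overpartition _]v.
  by rewrite -expr_sum coefsXn s eqxx.
move/negbT; rewrite negb_and => /orP[/forallPn[k /negbTE nv]|/negbTE s].
  by rewrite (_ : \prod_(_ < m) _ = 0) ?coefs0 // (bigD1 k) //= [odd_overpartition _]nv mul0r.
case: (boolP [forall k, odd_overpartition (t k)]) => [/forallP v|/forallPn[k /negbTE nv]].
  under eq_bigr => k _ do rewrite v.
  by rewrite -expr_sum coefsXn eq_sym s.
by rewrite (_ : \prod_(_ < m) _ = 0) ?coefs0 // (bigD1 k) //= nv mul0r.
Qed.

End Counting.

(** * The Jacobi triple product *)

Lemma coef_comp_scaleX (A : comNzRingType) (p : {poly A}) (c : A) i :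
  ((p \Po (c *: 'X)%R)`_i = c ^+ i * p`_i)%R.
Proof.
rewrite comp_polyE (eq_bigr (fun j : 'I__ => (p`_j * c ^+ j) *: 'X^j)%R); last first.
  by move=> j _; rewrite exprZn scalerA.
rewrite -(poly_def _ (fun j => (p`_j * c ^+ j)%R)) coef_poly [RHS]mulrC.
by case: ltnP => // le_pi; rewrite nth_default ?mul0r.
Qed.

Section FiniteJacobiTriple.
Local Open Scope ring_scope.
Variables (A : comNzRingType) (q : A).

(** The product of the (1 + q^(2k+1) X)(1 + q^(2k+1) X^(-1)), multiplied by X^n to become a
    polynomial; its central coefficient has index [n]. *)
Definition triple_poly n : {poly A} :=
  \prod_(k < n) ((1 + (q ^+ k.*2.+1) *: 'X) * ('X + (q ^+ k.*2.+1)%:P)).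

(** Replacing X by q^2 X moves each linear factor to its neighbour up to a power of q, so the
    product telescopes to its extreme factors. Induction on [n] avoids dividing by them. *)
Lemma triple_poly_dilate n :
  (triple_poly n \Po (q ^+ 2 *: 'X)) * (q *: 'X + (q ^+ n.*2)%:P) =
  (q ^+ n.*2)%:P * (1 + (q ^+ n.*2.+1) *: 'X) * triple_poly n.
Proof.
rewrite /triple_poly; elim: n => [|n IH].
  by rewrite !big_ord0 rmorph1 /= expr0 expr1 mulr1 !mul1r addrC.
rewrite !big_ord_recr /= rmorphM /= rmorphM /= !rmorphD /= rmorph1 /= !linearZ /=.
rewrite comp_polyX comp_polyC.
rewrite -!mul_polyC !doubleS !exprS !polyCM in IH *.
set B := _ \Po _ in IH *; set G := \prod_(i < n) _ in IH *.
set Q := q%:P in IH *; set T := (q ^+ n.*2)%:P in IH *.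
set X := 'X in IH *.
rewrite expr0 !mulr1.
transitivity (B * (Q * X + T) * (Q ^+ 2 * (1 + Q ^+ 3 * T * X) * (X + Q * T))); first ring.
by rewrite IH; ring.
Qed.

Lemma triple_coef_rec n l :
  q ^+ l.*2.+1 * (triple_poly n)`_l + q ^+ (n.*2 + l.*2.+2) * (triple_poly n)`_l.+1 =
  q ^+ n.*2 * ((triple_poly n)`_l.+1 + q ^+ n.*2.+1 * (triple_poly n)`_l).
Proof.
have /(congr1 (fun p : {poly A} => p`_l.+1)) := triple_poly_dilate n.
rewrite mulrDr -scalerAr coefD coefZ coefMX /= coefMC !coef_comp_scaleX.
rewrite -mulrA coefCM mulrDl mul1r coefD -scalerAl coefZ coefXM /= => <-.
rewrite -!exprM !mul2n doubleS exprD !exprS; ring.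
Qed.

Lemma size_triple_poly n : (size (triple_poly n) <= n.*2.+1)%N.
Proof.
rewrite /triple_poly; elim: n => [|n IH]; first by rewrite big_ord0 size_poly1.
rewrite big_ord_recr /=; set F := (1 + _) * _.
have size_lin (c d : A) : (size (c *: 'X + d%:P)%R <= 2)%N.
  rewrite (leq_trans (size_polyD _ _)) // geq_max (leq_trans (size_scale_leq _ _)) ?size_polyX //.
  by rewrite (leq_trans (size_polyC_leq1 _)).
have size_F : (size F <= 3)%N.
  rewrite /F -[X in _ * (X + _)]scale1r [1 + _]addrC -polyC1.
  rewrite (leq_trans (size_polyMleq _ _)) //.
  by rewrite -subn1 leq_subLR; apply: (leq_add (size_lin _ _) (size_lin _ _)).
rewrite (leq_trans (size_polyMleq _ _)) // -subn1 leq_subLR.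
by rewrite (leq_trans (leq_add IH size_F)) //; lia.
Qed.

(** As [e * e = 1], one has [e + Q = e * (1 + e * Q)], so the two linear factors agree up to [e]. *)
Lemma horner_triple_poly n (e : A) : e * e = 1 ->
  (triple_poly n).[e] = e ^+ n * \prod_(k < n) (1 + e * q ^+ k.*2.+1) ^+ 2.
Proof.
move=> e2; rewrite horner_prod -[X in e ^+ X](card_ord n) -prodr_const -big_split /=.
apply: eq_bigr => k _; rewrite !(hornerM, hornerD, hornerZ, hornerC, hornerX); set Q := q ^+ _.
transitivity (e + e * e * Q + Q + e * Q ^+ 2); first ring.
by rewrite e2; transitivity (e + (e * e * Q) *+ 2 + e * (e * e) * Q ^+ 2); [rewrite e2; ring|ring].
Qed.

End FiniteJacobiTriple.

Lemma sum_ord_center (V : nmodType) (F : nat -> V) n :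
  (\sum_(l < n.*2.+1) F l = F n + \sum_(j < n) (F (n + j.+1)%N + F (n - j.+1)%N))%R.
Proof.
rewrite -addnn -addSn addnC big_split_ord /= big_ord_recl /= addrCA big_split /= addn0.
congr (_ + _)%R.
rewrite [LHS]addrC; congr (_ + _)%R.
by rewrite (reindex_inj rev_ord_inj).
Qed.

Section Theta.
Local Open Scope ring_scope.
Local Notation q := (fpsX int).

Definition is_square n := [exists k : 'I_n.+1, k ^ 2 == n]%N.

Lemma is_squareP n : reflect (exists k, n = (k ^ 2)%N) (is_square n).
Proof.
apply: (iffP existsP) => [[k /eqP <-]|[k ->]]; first by exists k.
have kk : (k < (k ^ 2).+1)%N by rewrite ltnS -mulnn; nia.
by exists (Ordinal kk).
Qed.

Definition phi : fps int := Fps (fun n => if n == 0%N then 1 else (is_square n)%:R *+ 2).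

Definition phi_part n : fps int := 1 + (\sum_(j < n) q ^+ (j.+1 ^ 2)) *+ 2.

Lemma phi_partE n : eqmodX (n.+1 ^ 2) phi (phi_part n).
Proof.
move=> m mn; rewrite coefsD coefs1 coefsMn coefs_sum /=; case: eqP => [->|/eqP m0].
  by rewrite big1 ?mul0rn ?addr0 // => j _; rewrite coefsXn.
rewrite add0r; congr (_ *+ 2); case: is_squareP => [[[|k] mk]|nsq].
- by rewrite mk in m0.
- have kn : (k < n)%N by move: mn; rewrite mk ltn_sqr.
  rewrite (bigD1 (Ordinal kn)) //= coefsXn mk eqxx big1 ?addr0 // => j.
  by rewrite coefsXn eqn_sqr eqSS eq_sym -val_eqE /= => /negbTE ->.
- by rewrite big1 // => j _; rewrite coefsXn; case: eqP => // mj; case: nsq; exists j.+1.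
Qed.

Local Notation g n l := ((triple_poly q n)`_l).

(* The recurrence becomes g_(l+1) = q^(2(l-n)+1) g_l once q^n.*2 is cancelled and
   the terms of order n.*2.+1 are dropped, so the coefficients around the central
   one are those of the theta series. *)
Lemma triple_coef_up n j : eqmodX n.*2.+1 (g n (n + j)) (q ^+ (j ^ 2) * g n n).
Proof.
elim: j => [|j IH]; first by rewrite addn0 mul1r.
have := triple_coef_rec q n (n + j).
have -> : (n.*2 + (n + j).*2.+2 = n.*2 + (n.*2.+1 + j.*2.+1))%N by lia.
have -> : ((n + j).*2.+1 = n.*2 + j.*2.+1)%N by lia.
rewrite !exprD -!mulrA -mulrDr => /fpsX_reg; rewrite -/(g n _) -/(g n _) => E.
rewrite addnS; apply: (@eqmodX_trans _ _ (q ^+ j.*2.+1 * g n (n + j))).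
  have -> : g n (n + j).+1 = q ^+ j.*2.+1 * g n (n + j) +
     q ^+ n.*2.+1 * (q ^+ j.*2.+1 * g n (n + j).+1 - g n (n + j)).
    by rewrite mulrBr addrA E addrK.
  by move=> m mn; rewrite coefsD [X in _ + X]coefsXnM mn addr0.
have -> : (j.+1 ^ 2 = j.*2.+1 + j ^ 2)%N by lia.
by rewrite exprD -mulrA; apply: eqmodXM.
Qed.

(** The same recurrence solved for the lower coefficient; the power to cancel is now [q ^+ l], where
    q^(2n) = q^l q^(2j+1). *)
Lemma triple_coef_down n j : (j <= n)%N ->
  eqmodX n.*2.+1 (g n (n - j)) (q ^+ (j ^ 2) * g n n).
Proof.
elim: j => [|j IH] jn; first by rewrite subn0 mul1r.
have := triple_coef_rec q n (n - j.+1).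
have -> : (n - j.+1).+1 = (n - j)%N by lia.
set l := (n - j.+1).*2.+1.
have -> : (n.*2 + (n - j.+1).*2.+2 = l + n.*2.+1)%N by lia.
have En : (n.*2 = l + j.*2.+1)%N by lia.
have -> : q ^+ n.*2 = q ^+ l * q ^+ j.*2.+1 by rewrite -exprD -En.
rewrite exprD -!mulrA -mulrDr => /fpsX_reg; rewrite -/(g n _) -/(g n _) => E.
apply: (@eqmodX_trans _ _ (q ^+ j.*2.+1 * g n (n - j))).
  have -> : g n (n - j.+1) = q ^+ j.*2.+1 * g n (n - j) +
     q ^+ n.*2.+1 * (q ^+ j.*2.+1 * g n (n - j.+1) - g n (n - j)).
    by apply: (addIr (q ^+ n.*2.+1 * g n (n - j))); rewrite E; ring.
  by move=> m mn; rewrite coefsD [X in _ + X]coefsXnM mn addr0.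
have -> : (j.+1 ^ 2 = j.*2.+1 + j ^ 2)%N by lia.
by rewrite exprD -mulrA; apply: eqmodXM => //; apply: IH; lia.
Qed.

(** Evaluating the finite triple product at [e] pairs the coefficients at equal distance from the
    centre. The central one stays unevaluated: it cancels in the quotient of the cases 1 and -1. *)
Lemma prod_odd_theta n (e : fps int) : e * e = 1 ->
  eqmodX n.*2.+1 (\prod_(k < n) (1 + e * q ^+ k.*2.+1) ^+ 2)
    (g n n * (1 + (\sum_(j < n) e ^+ j.+1 * q ^+ (j.+1 ^ 2)) *+ 2)).
Proof.
move=> e2; have en : e ^+ n * e ^+ n = 1 by rewrite -exprMn e2 expr1n.
have -> : \prod_(k < n) (1 + e * q ^+ k.*2.+1) ^+ 2 = e ^+ n * (triple_poly q n).[e].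
  by rewrite horner_triple_poly // mulrA en mul1r.
rewrite (horner_coef_wide _ (size_triple_poly q n))
  (sum_ord_center (fun l => g n l * e ^+ l)) mulrDr.
rewrite mulrCA en mulr1 mulrDr mulr1; apply: eqmodXD => //.
rewrite mulr_sumr -sumrMnl mulr_sumr; apply: eqmodX_sum => j _.
have e_up : e ^+ n * e ^+ (n + j.+1) = e ^+ j.+1 by rewrite exprD mulrA en mul1r.
have e_down : e ^+ n * e ^+ (n - j.+1) = e ^+ j.+1.
  by rewrite -{1}(subnK (ltn_ord j)) exprD mulrAC -exprMn e2 expr1n mul1r.
rewrite mulrDr (mulrCA _ (g n (n + j.+1))) (mulrCA _ (g n (n - j.+1))) e_up e_down -mulrDl.
have -> : g n n * (e ^+ j.+1 * q ^+ (j.+1 ^ 2) *+ 2) =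
    (q ^+ (j.+1 ^ 2) * g n n + q ^+ (j.+1 ^ 2) * g n n) * e ^+ j.+1.
  set Q := q ^+ _; set T := e ^+ _; ring.
by apply: eqmodXM => //; apply: eqmodXD; [apply: triple_coef_up | apply: triple_coef_down].
Qed.

Lemma eqmodX_neg N (f f' : fps int) : eqmodX N f f' -> eqmodX N (fps_neg f) (fps_neg f').
Proof. by move=> e n nN /=; rewrite e. Qed.

Lemma fps_negX : fps_neg q = - q.
Proof. by apply: fpsP => -[|[|n]]; rewrite ?coefsN //= ?mulr0 ?oppr0 // mulr1. Qed.

Lemma prod_odd_phi n :
  eqmodX n.*2.+1 (\prod_(k < n) (1 + q ^+ k.*2.+1) ^+ 2) (g n n * phi).
Proof.
have := @prod_odd_theta n 1 (mulr1 1).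
under eq_bigr do rewrite mul1r.
under [X in _ * (1 + X *+ 2)]eq_bigr do rewrite expr1n mul1r.
move/eqmodX_trans; apply; apply: eqmodXM => //; apply/eqmodX_sym.
by apply: eqmodXW (@phi_partE n); nia.
Qed.

Lemma prod_odd_neg_phi n :
  eqmodX n.*2.+1 (\prod_(k < n) (1 - q ^+ k.*2.+1) ^+ 2) (g n n * fps_neg phi).
Proof.
have e2 : -1 * -1 = 1 :> fps int by rewrite mulrNN mulr1.
have := @prod_odd_theta n _ e2.
under eq_bigr do rewrite mulN1r.
move/eqmodX_trans; apply; apply: eqmodXM => //; apply/eqmodX_sym.
have -> : 1 + (\sum_(j < n) (-1) ^+ j.+1 * q ^+ (j.+1 ^ 2)) *+ 2 = fps_neg (phi_part n).
  rewrite rmorphD rmorph1 rmorphMn rmorph_sum; congr (_ + _ *+ 2).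
  apply: eq_bigr => j _; rewrite rmorphXn /= fps_negX [RHS]exprNn; congr (_ * _).
  by rewrite -[in RHS]signr_odd oddX orFb signr_odd.
by apply: eqmodX_neg; apply: eqmodXW (@phi_partE n); nia.
Qed.

End Theta.

(** * Sums of two squares *)

Section SumsOfTwoSquares.
Local Open Scope ring_scope.
Local Notation q := (fpsX int).

Definition int_range N : seq int := [seq Posz i | i <- iota 0 N.+1] ++ [seq Negz i | i <- iota 0 N].

Lemma mem_int_range N (a : int) : (a \in int_range N) = (`|a| <= N)%N.
Proof.
rewrite mem_cat; apply/orP/idP => [[/mapP[i]|/mapP[i]]|].
- by rewrite mem_iota => ? ->; lia.
- by rewrite mem_iota => ? ->; lia.
case: a => i iN; [left|right]; apply/mapP; exists i => //; rewrite mem_iota; lia.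
Qed.

Lemma int_range_uniq N : uniq (int_range N).
Proof.
rewrite cat_uniq !map_inj_uniq ?iota_uniq ?andbT /=; try by move=> ? ? [].
by apply/hasPn => a /mapP[i _ ->]; apply/mapP => -[j _].
Qed.

Lemma phi_part_int_range N : phi_part N = \sum_(a <- int_range N) q ^+ (`|a| ^ 2).
Proof.
rewrite big_cat !big_map -[iota 0 N.+1]/(0%N :: iota 1 N) big_cons (iotaDl 1 0) big_map.
rewrite /= -addrA; congr (_ + _); rewrite mulr2n -(big_mkord xpredT (fun j => q ^+ (j.+1 ^ 2))).
by rewrite /index_iota subn0.
Qed.

Definition two_squares N n :=
  [seq ab <- [seq (a, b) | a <- int_range N, b <- int_range N] |
    ab.1 * ab.1 + ab.2 * ab.2 == Posz n].

Lemma mem_two_squares N n a b : (n <= N)%N ->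
  ((a, b) \in two_squares N n) = (a * a + b * b == Posz n).
Proof.
move=> nN; apply/idP/idP => [|/eqP ab]; rewrite mem_filter; first by case/andP.
rewrite ab eqxx andTb; apply/allpairsPdep.
by exists a, b; rewrite !mem_int_range; split=> //; nia.
Qed.

Lemma two_squares_uniq N n : uniq (two_squares N n).
Proof.
by rewrite filter_uniq // allpairs_uniq ?int_range_uniq // => -[? ?] [? ?] _ _ [-> ->].
Qed.

Lemma coefs_phi2 N n : (n <= N)%N -> coefs (phi ^+ 2) n = (size (two_squares N n))%:R.
Proof.
move=> nN; have e := @phi_partE N.
rewrite expr2 (eqmodXM e e); last by nia.
rewrite phi_part_int_range big_distrlr /= coefs_sum size_filter -sum1_count natr_sum.
rewrite [RHS]big_mkcond big_allpairs; apply: eq_bigr => a _.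
rewrite coefs_sum; apply: eq_bigr => b _; rewrite -exprD coefsXn /=.
have -> : (a * a + b * b == Posz n) = (n == `|a| ^ 2 + `|b| ^ 2)%N by apply/eqP/eqP; nia.
by case: (n == _).
Qed.

(** The map (u, v) -> (u + v, u - v) is a bijection from the representations of n as a sum of two
    squares onto those of 2n. *)
Lemma U_phi2 : fps_U (phi ^+ 2) = phi ^+ 2.
Proof.
apply: fpsP => n; rewrite -[LHS]/(coefs (phi ^+ 2) n.*2).
have nn : (n <= n.*2)%N by lia.
rewrite (coefs_phi2 (leqnn _)) (coefs_phi2 nn); congr (_%:R).
(* a^2 + b^2 = 2n forces a and b to have the same parity. *)
pose f (u : int * int) := (u.1 + u.2, u.1 - u.2).
have f_inj : injective f by move=> [u v] [u' v'] [? ?]; congr (_, _); lia.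
rewrite -[RHS](size_map f); apply: perm_size; apply: uniq_perm.
- exact: two_squares_uniq.
- by rewrite map_inj_uniq // two_squares_uniq.
move=> [a b]; rewrite mem_two_squares //; apply/eqP/mapP => [ab|[[u v]]]; last first.
  by rewrite mem_two_squares // => /eqP uv [-> ->]; rewrite /=; nia.
have [u [v [au bv]]] : exists u v, a = u + v /\ b = u - v.
  have [ka [ra [Ea Ra]]] : exists k r, a = 2 * k + r /\ (r = 0 \/ r = 1).
    by exists (a %/ 2)%Z, (a %% 2)%Z; lia.
  have [kb [rb [Eb Rb]]] : exists k r, b = 2 * k + r /\ (r = 0 \/ r = 1).
    by exists (b %/ 2)%Z, (b %% 2)%Z; lia.
  have rr : ra = rb by case: Ra Rb => [] ? [] ?; subst; nia.
  by exists (ka + kb + ra), (ka - kb); lia.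
exists (u, v); last by rewrite au bv.
rewrite mem_two_squares //; apply/eqP; move: ab; rewrite au bv; nia.
Qed.

End SumsOfTwoSquares.

(** * The modular equations *)

Section OverpartitionSeries.
Local Open Scope ring_scope.
Local Notation q := (fpsX int).
Local Notation neg := (@fps_neg int).
Local Notation sq := (@fps_sq int).
Local Notation U := (@fps_U int).

Lemma fps_mulIn (f g : fps int) k : f *+ k.+1 = g *+ k.+1 -> f = g.
Proof.
move=> e; apply: fpsP => n; move/(congr1 (fun u => coefs u n)): e.
by rewrite !coefsMn => /(pmulrnI (ltn0Sn k)).
Qed.

(** Over the integers a nonzero constant coefficient suffices; below it is 2, which is not
    invertible. *)
Lemma eqmodX_cancel_int N (u f g : fps int) : coefs u 0 != 0 ->
  eqmodX N (f * u) (g * u) -> eqmodX N f g.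
Proof.
move=> u0 e; suff h0 n : (n < N)%N -> coefs (f - g) n = 0.
  by move=> n nN; apply/eqP; rewrite -subr_eq0; apply/eqP/(h0 n).
elim/ltn_ind: n => n IH nN; apply: (mulIf u0); rewrite mul0r.
have : coefs ((f - g) * u) n = 0 by rewrite mulrBl coefsD coefsN e // subrr.
rewrite coefsM big_ord_recr /= subnn big1 ?add0r // => i _.
by rewrite -[X in X * _]/(coefs (f - g) i) IH ?mul0r // (ltn_trans (ltn_ord i)).
Qed.

Lemma eqmodX_sqr_inj N (f g : fps int) : coefs f 0 = 1 -> coefs g 0 = 1 ->
  eqmodX N (f ^+ 2) (g ^+ 2) -> eqmodX N f g.
Proof.
move=> f0 g0 e; apply: (@eqmodX_cancel_int _ (f + g)); first by rewrite coefsD f0 g0.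
have -> : f * (f + g) = f ^+ 2 + f * g by ring.
have -> : g * (f + g) = g ^+ 2 + f * g by ring.
exact: eqmodXD.
Qed.

Lemma is_square4 n : is_square n.*2.*2 = is_square n.
Proof.
apply/is_squareP/is_squareP => [[k nk]|[k ->]]; last by exists k.*2; nia.
exists k./2; have := odd_double_half k; case: (odd k) => /= kk; nia.
Qed.

Lemma is_square_double_odd n : odd n -> is_square n.*2 = false.
Proof.
move=> n_odd; apply/is_squareP => -[k nk].
have := odd_double_half k; have := odd_double_half n; rewrite n_odd.
by case: (odd k) => /=; nia.
Qed.

Lemma U_phi : U phi = sq phi.
Proof.
apply: fpsP => n /=; case: (boolP (odd n)) => [n_odd|n_even].
  by rewrite is_square_double_odd //; case: n n_odd.
rewrite -{1 2}(even_halfK n_even) is_square4.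
by congr (if _ then _ else _); lia.
Qed.

(** This is q psi(q^8) for Ramanujan's psi, the series of the q^(k(k+1)/2). *)
Definition psi : fps int := Fps (fun n => (odd n && is_square n)%:R).

Lemma phi_psi : phi = sq (sq phi) + psi *+ 2.
Proof.
apply: fpsP => n; rewrite -U_phi coefsD coefsMn /=; case: (boolP (odd n)) => n_odd.
  by rewrite add0r; case: n n_odd.
by rewrite mul0rn addr0 (even_halfK n_odd).
Qed.

Lemma neg_phi_psi : neg phi = sq (sq phi) - psi *+ 2.
Proof.
rewrite {1}phi_psi rmorphD rmorphMn /= neg_sq -mulNrn; congr (_ + _ *+ 2).
by apply: fpsP => n /=; rewrite -signr_odd; case: odd; rewrite ?mulN1r //= mulr0 oppr0.
Qed.

(** Twice the right side is phi(q)^2 + phi(-q)^2, that is twice the even part of phi^2, which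
    [U_phi2] evaluates. *)
Lemma sq_phi2 : (sq phi) ^+ 2 = (sq (sq phi)) ^+ 2 + (psi *+ 2) ^+ 2.
Proof.
apply: (@fps_mulIn _ _ 1); rewrite -rmorphXn -{1}U_phi2 -add_neg rmorphXn /=.
by rewrite neg_phi_psi {1}phi_psi; ring.
Qed.

(** With a = phi(q^4) and b = 2 psi, the left side is a^2 - b^2 = 2a^2 - phi(q^2)^2. Let A and B be
    a and b taken at q^2: by [sq_phi2] at q^2 this is 2(A^2 + B^2) - (A + B)^2 = (A - B)^2. *)
Lemma phi_neg_phi : phi * neg phi = (sq (neg phi)) ^+ 2.
Proof.
have e1 := congr1 sq sq_phi2; rewrite rmorphXn rmorphD !rmorphXn /= in e1.
have e2 := sq_phi2; rewrite {1}phi_psi rmorphD /= in e2.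
rewrite {1}phi_psi neg_phi_psi rmorphB /=.
set a := sq (sq phi) in e1 e2 *; set b := psi *+ 2 in e1 e2 *.
transitivity (a ^+ 2 *+ 2 - (a ^+ 2 + b ^+ 2)); first ring.
by rewrite -e2 e1; ring.
Qed.

Definition inv_neg_phi : fps int := fps_inv (neg phi).
Local Notation v := inv_neg_phi.

Lemma neg_phiV : neg phi * v = 1.
Proof. by rewrite fps_mulV //= mul1r. Qed.

(** The closed form phi(q) / phi(-q^2) of the square root of phi(q) / phi(-q); [prod_odd_part_P]
    identifies it with the generating product. *)
Definition odd_overpart_fps : fps int := phi * sq v.

Local Notation P := odd_overpart_fps.

Lemma coefs_P0 : coefs P 0 = 1.
Proof. by rewrite coefsM0 /= big_ord1 expr0 coefs1 mul1r. Qed.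

Lemma neg_P : neg P = neg phi * sq v.
Proof. by rewrite rmorphM /= neg_sq. Qed.

Lemma sq_neg_phiV : sq (neg phi) * sq v = 1.
Proof. by rewrite -rmorphM neg_phiV rmorph1. Qed.

Lemma P_neg : P * neg P = 1.
Proof.
rewrite neg_P /P mulrACA phi_neg_phi -[sq v * _]expr2 -exprMn.
by rewrite sq_neg_phiV expr1n.
Qed.

Lemma P2 : P ^+ 2 = phi * v.
Proof.
rewrite -[LHS]mulr1 -neg_phiV mulrA; congr (_ * _).
transitivity (phi * (phi * neg phi) * sq v ^+ 2); first by rewrite /P; ring.
by rewrite phi_neg_phi -mulrA -exprMn sq_neg_phiV expr1n mulr1.
Qed.

(** Dividing phi(q)^2 + phi(-q)^2 = 2 phi(q^2)^2 by phi(-q^2)^2 leaves twice the square of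
    P(q^2)^2. *)
Lemma P2D : P ^+ 2 + neg P ^+ 2 = sq P ^+ 4 *+ 2.
Proof.
transitivity ((phi ^+ 2 + neg (phi ^+ 2)) * sq v ^+ 2).
  by rewrite neg_P /P rmorphXn; ring.
rewrite add_neg U_phi2 mulrnAl; congr (_ *+ 2).
rewrite -!rmorphXn -rmorphM; congr sq.
by rewrite -[4%N]/(2 * 2)%N exprM P2 exprMn.
Qed.

Lemma prod_odd_uphalf (F : nat -> fps int) n :
  \prod_(j < n.+1 | odd j) F j = \prod_(k < uphalf n) F k.*2.+1.
Proof.
elim: n => [|n IH]; first by rewrite big_mkcond big_ord1 big_ord0.
rewrite big_mkcond big_ord_recr /= -big_mkcond IH uphalf_half.
case: (boolP (odd n)) => n_odd; rewrite /= ?mulr1 ?add0n //.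
by rewrite big_ord_recr /= even_halfK.
Qed.

Lemma odd_part_fpsE n j : (0 < j)%N ->
  eqmodX n.+1 ((1 - q ^+ j) * odd_part_fps n j) (1 + q ^+ j).
Proof.
move=> j0; rewrite /odd_part_fps.
have -> : \sum_(c < n) q ^+ (c.+1 * j) = q ^+ j * \sum_(c < n) (q ^+ j) ^+ c.
  by rewrite mulr_sumr; apply: eq_bigr => c _; rewrite -exprM -exprD; congr (q ^+ _); lia.
set y := q ^+ j; set S := \sum_(c < n) _.
have -> : (1 - y) * (1 + (y * S) *+ 2) = 1 + y - (y * y ^+ n) *+ 2.
  have := subrX1 y n; rewrite -/S => E.
  have -> : y ^+ n = 1 + (y - 1) * S by rewrite -E; ring.
  ring.
(* The geometric sum stops after [n] terms, so the error has order (n+1)j, at least n+1 since j >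
   0. *)
move=> m mn; rewrite coefsD coefsN coefsMn -exprS -exprM.
by rewrite (@eqmodX_Xn _ n.+1 _ _ m mn) ?coefs0 ?mul0rn ?subr0 //; nia.
Qed.

(** The products of the (1 + q^j)^2 and of the (1 - q^j)^2 are phi(q) and phi(-q) up to the same
    factor [g]. Cancelling [g * neg phi] shows that [Q] and [P] have the same square modulo q^(n+1),
    and both have constant coefficient 1. *)
Lemma prod_odd_part_P n : eqmodX n.+1 (\prod_(j < n.+1 | odd j) odd_part_fps n j) P.
Proof.
rewrite prod_odd_uphalf; set Q := \prod_(k < _) _; set N := uphalf n.
have nN : (n.+1 <= N.*2.+1)%N by rewrite /N; lia.
have c0 (F : nat -> fps int) : (forall k, coefs (F k) 0 = 1) ->
    coefs (\prod_(k < N) F k) 0 = 1.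
  move=> F0; apply: (big_ind (fun f => coefs f 0 = 1)) => // f g f0 g0.
  by rewrite coefsM0 f0 g0.
have Xodd0 k : coefs (q ^+ k.*2.+1) 0 = 0 by rewrite coefsXn.
set g := (triple_poly q N)`_N.
have ep := eqmodXW nN (@prod_odd_phi N); have em := eqmodXW nN (@prod_odd_neg_phi N).
have g0 : coefs g 0 = 1.
  have := ep 0%N isT; rewrite (c0 (fun k => (1 + q ^+ k.*2.+1) ^+ 2)) => [|k].
    by rewrite coefsM0 mulr1.
  by rewrite coefsX0 coefsD coefs1 Xodd0 addr0 expr1n.
have Q0 : coefs Q 0 = 1.
  apply: (c0 (fun k => odd_part_fps n k.*2.+1)) => k; rewrite coefsD coefs1 coefsMn coefs_sum.
  rewrite big1 ?mul0rn ?addr0 // => c _.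
  by rewrite coefsXn; case: eqP => //; lia.
apply: eqmodX_sqr_inj; rewrite ?coefs_P0 //.
apply: (@eqmodX_cancel _ _ (g * neg phi)); first by rewrite coefsM0 g0 /= mulr1.
apply: eqmodX_trans (eqmodXM (eqmodX_refl (Q ^+ 2)) (eqmodX_sym em)) _.
have -> : P ^+ 2 * (g * neg phi) = g * phi by rewrite P2 -[RHS]mulr1 -neg_phiV; ring.
apply: eqmodX_trans ep; rewrite -prodrXl -big_split /=; apply: eqmodX_prod => k _.
by rewrite mulrC -exprMn; apply: eqmodX_exp; apply: odd_part_fpsE.
Qed.

Lemma OPT_coefs_P m n : (OPT m n)%:R = coefs (P ^+ m) n.
Proof. by rewrite OPT_coefs; apply: (eqmodX_exp m (@prod_odd_part_P n)). Qed.

End OverpartitionSeries.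

(** * Iterating the extraction of even coefficients *)

Section EvenPartIteration.
Local Open Scope ring_scope.
Local Notation neg := (@fps_neg int).
Local Notation sq := (@fps_sq int).
Local Notation U := (@fps_U int).
Local Notation v := inv_neg_phi.
Local Notation P := odd_overpart_fps.

(** As phi(q) and phi(-q) are phi(q^4) plus and minus 2 psi, their squares differ by 8 phi(q^4) psi;
    dividing by phi(-q)^2 gives P^4 - 1 = 8x. *)
Definition fps_x : fps int := sq (sq phi) * psi * v ^+ 2.
Definition fps_z : fps int := fps_x *+ 4.
Local Notation x := fps_x.
Local Notation z := fps_z.

Lemma P4 : P ^+ 4 = 1 + z *+ 2.
Proof.
rewrite -[4%N]/(2 * 2)%N exprM P2 -(expr1n _ 2) -neg_phiV /z /x !exprMn {1}phi_psi neg_phi_psi.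
by ring.
Qed.

Lemma neg_P_sqr : P ^+ 2 * neg P ^+ 2 = 1.
Proof. by rewrite -exprMn P_neg expr1n. Qed.

Lemma sqP4 : sq P ^+ 4 = 1 + sq z *+ 2.
Proof. by rewrite -rmorphXn P4 rmorphD rmorphMn rmorph1. Qed.

(** Multiply P(q)^2 + P(-q)^2 = 2 P(q^2)^4 by P^(k+2), use P(q) P(-q) = 1, and apply [U], which lets
    P(q^2)^4 out as P^4. *)
Lemma U_P_rec k : U (P ^+ (k + 4)) = P ^+ 4 * U (P ^+ (k + 2)) *+ 2 - U (P ^+ k).
Proof.
apply: (addIr (U (P ^+ k))); rewrite subrK -raddfD /= -U_sqM rmorphXn /= -raddfMn /=; congr U.
rewrite -mulrnAl -P2D !exprD; transitivity (P ^+ k * P ^+ 4 + P ^+ k * (P ^+ 2 * neg P ^+ 2)).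
  by rewrite neg_P_sqr mulr1.
by ring.
Qed.

Definition fps_g := U P.
Local Notation g := fps_g.
Definition fps_w := g * P ^+ 2.
Local Notation w := fps_w.

(** The same recurrence at exponent -1: the inverse P(-q) of P has the same even part as P. *)
Lemma U_P3 : U (P ^+ 3) = g * (1 + z *+ 4).
Proof.
have -> : g * (1 + z *+ 4) = P ^+ 4 * U P *+ 2 - U (neg P) by rewrite P4 U_neg -/g; ring.
apply: (addIr (U (neg P))); rewrite subrK -raddfD /= -U_sqM rmorphXn /= -raddfMn /=; congr U.
rewrite -mulrnAl -P2D; transitivity (P ^+ 3 + P * neg P * neg P); first by rewrite P_neg mul1r.
by ring.
Qed.

Lemma U_P5 : U (P ^+ 5) = g * (1 + z *+ 12 + z ^+ 2 *+ 16).
Proof. by rewrite (U_P_rec 1) U_P3 P4 expr1 -/g; ring. Qed.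

Lemma U_P7 : U (P ^+ 7) = g * (1 + z *+ 24 + z ^+ 2 *+ 80 + z ^+ 3 *+ 64).
Proof. by rewrite (U_P_rec 3) U_P5 P4 U_P3; ring. Qed.

(** Squaring 2 g(q^2) = P(q) + P(-q) gives 4 g^2 = 2 P^4 + 2, and [P2D] gives the same value for 4
    P(q)^2 P(q^2)^4. Constant coefficients 1 fix the square root. *)
Lemma gE : g = P * sq P ^+ 2.
Proof.
apply: eqmodX_eq => N; apply: eqmodX_sqr_inj; [exact: coefs_P0| |].
  by rewrite coefsM0 coefsX0 -[coefs (sq P) 0]/(coefs P 0) coefs_P0 expr1n mulr1.
suff -> : g ^+ 2 = (P * sq P ^+ 2) ^+ 2 by [].
apply: (@fps_mulIn _ _ 3); apply: sq_inj.
transitivity (sq (P ^+ 4 *+ 2 + 2)).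
  transitivity ((sq g *+ 2) ^+ 2); first by rewrite rmorphMn rmorphXn /=; ring.
  rewrite -add_neg rmorphD rmorph_nat rmorphMn rmorphXn /= -P2D.
  transitivity (P ^+ 2 + neg P ^+ 2 + (P * neg P) *+ 2); first ring.
  by rewrite P_neg.
congr sq.
transitivity (P ^+ 2 * (sq P ^+ 4 *+ 2) *+ 2); last ring.
rewrite -P2D mulrDr neg_P_sqr; ring.
Qed.

Lemma U_gM f : U (g * f) = P ^+ 2 * U (P * f).
Proof. by rewrite -U_sqM rmorphXn gE; congr U; ring. Qed.

Lemma U_g : U g = w.
Proof. by rewrite -[g in U g]mulr1 U_gM mulr1 mulrC. Qed.

Lemma U_w : U w = w * (1 + z *+ 4).
Proof. by rewrite U_gM -exprS U_P3 /w; ring. Qed.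

Lemma fps_zMn2 : z *+ 2 = P ^+ 4 - 1.
Proof. by rewrite P4; ring. Qed.

(** Writing 2z = P^4 - 1 reduces this to [U] of odd powers of P; the doubling is undone over the
    integers. *)
Lemma U_gz : U (g * z) = w * z * (3 + z *+ 4) *+ 2.
Proof.
apply: (@fps_mulIn _ _ 1); rewrite -raddfMn /= -[X in U X]mulrnAr fps_zMn2 U_gM mulrBr mulr1 -exprS.
by rewrite raddfB /= U_P5 -/g /w; ring.
Qed.

Lemma U_wz : U (w * z) = w * z * (5 + z *+ 20 + z ^+ 2 *+ 16) *+ 2.
Proof.
apply: (@fps_mulIn _ _ 1); rewrite -raddfMn /= -[X in U X]mulrnAr fps_zMn2 -[X in U X]mulrA U_gM.
have -> : P * (P ^+ 2 * (P ^+ 4 - 1)) = P ^+ 7 - P ^+ 3 by ring.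
by rewrite raddfB /= U_P7 U_P3 /w; ring.
Qed.

(** The square of P^4 + 1 = 2 P^2 P(q^2)^4, written in z. It makes z quadratic over the series in
    q^2, so degrees in z can be lowered under [U]. *)
Lemma z_quadratic : z ^+ 2 = sq (z + z ^+ 2) * (z *+ 8 + 4).
Proof.
apply: (@fps_mulIn _ _ 3); apply: (addIr (4 + z *+ 8)).
transitivity ((1 + P ^+ 4) ^+ 2); first by rewrite P4; ring.
transitivity ((sq P ^+ 4 *+ 2) ^+ 2 * P ^+ 4).
  rewrite -P2D; transitivity ((P ^+ 4 + P ^+ 2 * neg P ^+ 2) ^+ 2); last ring.
  by rewrite neg_P_sqr addrC.
by rewrite sqP4 P4 (rmorphD _ z) /= rmorphXn /=; ring.
Qed.

(** * Integer polynomials in [z] under [U] *)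

Definition in_Zz (f : fps int) := exists p : {poly int}, f = (map_poly intr p).[z].

Lemma in_Zz_int (c : int) : in_Zz c%:~R.
Proof. by exists c%:P; rewrite map_polyC hornerC. Qed.

Lemma in_Zz_nat n : in_Zz n%:R.
Proof. exact: (in_Zz_int n). Qed.

Lemma in_Zz_z : in_Zz z.
Proof. by exists 'X; rewrite map_polyX hornerX. Qed.

Lemma in_ZzD f h : in_Zz f -> in_Zz h -> in_Zz (f + h).
Proof. by move=> [p ->] [p' ->]; exists (p + p'); rewrite rmorphD hornerD. Qed.

Lemma in_ZzN f : in_Zz f -> in_Zz (- f).
Proof. by move=> [p ->]; exists (- p); rewrite rmorphN hornerN. Qed.

Lemma in_ZzM f h : in_Zz f -> in_Zz h -> in_Zz (f * h).
Proof. by move=> [p ->] [p' ->]; exists (p * p'); rewrite rmorphM hornerM. Qed.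

Lemma in_ZzMn f k : in_Zz f -> in_Zz (f *+ k).
Proof. by rewrite -mulr_natr => Zf; apply: in_ZzM => //; apply: in_Zz_nat. Qed.

Lemma in_ZzX f k : in_Zz f -> in_Zz (f ^+ k).
Proof.
by move=> Zf; elim: k => [|k IH]; [apply: (in_Zz_nat 1) | rewrite exprS; apply: in_ZzM].
Qed.

Ltac in_Zz := repeat (first [exact: in_Zz_z | assumption | exact: in_Zz_nat | exact: in_Zz_int
  | exact: (in_Zz_nat 1) | apply: in_ZzD | apply: in_ZzN | apply: in_ZzMn | apply: in_ZzM
  | apply: in_ZzX]).

(** Both claims are proved together by induction on the degree: at f z + c the first calls the
    second at f, while the second replaces z^2 by [z_quadratic] and calls both. It serves for [y]
    equal to [g] and to [w]. *)
Lemma U_mul_in_Zz y : (exists2 a, in_Zz a & U y = w * a) ->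
  (exists2 a, in_Zz a & U (y * z) = w * z * a *+ 2) ->
  forall f, in_Zz f -> (exists2 a, in_Zz a & U (y * f) = w * a) /\
    (exists2 a, in_Zz a & U (y * z * f) = w * z * a *+ 2).
Proof.
move=> [a0 Za0 e0] [a1 Za1 e1] _ [p ->].
elim/poly_ind: p => [|p c [[b0 Zb0 f0] [b1 Zb1 f1]]].
  rewrite rmorph0 horner0 !mulr0 raddf0.
  by split; exists 0; rewrite ?mulr0 ?mul0rn //; apply: (in_Zz_nat 0).
rewrite rmorphD rmorphM /= map_polyX map_polyC hornerMXaddC.
set f := (map_poly _ p).[z] in f0 f1 *; split.
- exists (z * b1 *+ 2 + a0 * c%:~R); first by in_Zz.
  have -> : y * (f * z + c%:~R) = y * z * f + y *~ c by rewrite -mulrzr; ring.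
  by rewrite raddfD raddfMz /= f1 e0 -mulrzr; ring.
- exists ((1 + z) * (z * b1 *+ 8 + b0 *+ 2) + a1 * c%:~R); first by in_Zz.
  have -> : y * z * (f * z + c%:~R) = y * f * z ^+ 2 + (y * z) *~ c by rewrite -mulrzr; ring.
  rewrite raddfD raddfMz /= e1 z_quadratic mulrCA U_sqM.
  have -> : y * f * (z *+ 8 + 4) = y * z * f *+ 8 + y * f *+ 4 by ring.
  by rewrite raddfD !raddfMn /= f0 f1 -mulrzr; ring.
Qed.

Lemma U_gz_in_Zz f : in_Zz f -> exists2 a, in_Zz a & U (g * z * f) = w * z * a *+ 2.
Proof.
move=> Zf; apply: (proj2 (U_mul_in_Zz _ _ Zf)).
  by exists 1; rewrite ?U_g ?mulr1 //; in_Zz.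
by exists (3 + z *+ 4); rewrite ?U_gz //; in_Zz.
Qed.

Lemma U_wz_in_Zz f : in_Zz f -> exists2 a, in_Zz a & U (w * z * f) = w * z * a *+ 2.
Proof.
move=> Zf; apply: (proj2 (U_mul_in_Zz _ _ Zf)).
  by exists (1 + z *+ 4); rewrite ?U_w //; in_Zz.
by exists (5 + z *+ 20 + z ^+ 2 *+ 16); rewrite ?U_wz //; in_Zz.
Qed.

(** By [U_P_rec] two consecutive odd exponents determine the next one; modulo 4z, and up to the
    factor [g], the values 1 and 1 yield 2 - 1 = 1. *)
Lemma U_P_odd r : exists2 a, in_Zz a & U (P ^+ r.*2.+1) = g * (1 + z * a *+ 4).
Proof.
suff [] : (exists2 a, in_Zz a & U (P ^+ r.*2.+1) = g * (1 + z * a *+ 4)) /\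
  (exists2 a, in_Zz a & U (P ^+ r.*2.+3) = g * (1 + z * a *+ 4)) by [].
elim: r => [|r [[a Za ea] [b Zb eb]]].
  split; first by exists 0; [exact: (in_Zz_nat 0) | rewrite mulr0 mul0rn addr0 mulr1].
  by exists 1; [in_Zz | rewrite mulr1 U_P3].
split; first by exists b.
exists ((1 + z *+ 2) * b *+ 2 + 1 - a); first by in_Zz.
rewrite (_ : r.+1.*2.+3 = (r.*2.+1 + 4)%N); last by lia.
rewrite U_P_rec (_ : (r.*2.+1 + 2)%N = r.*2.+3); last by lia.
by rewrite ea eb P4; ring.
Qed.

(** The first difference is w(1 + 4z) - w = 4wz, up to an element of 8wz Z[z]. Each further [U]
    gains exactly one factor 2, since [5 + z *+ 20 + z ^+ 2 *+ 16] in [U_wz] is 1 modulo 2 and the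
    image of the error term stays even relative to the main one. *)
Lemma iter_U_P_sub r k : exists2 b, in_Zz b &
  iter k.+3 U (P ^+ r.*2.+1) - iter k.+2 U (P ^+ r.*2.+1) =
    w * z * (1 + b *+ 2) *+ (4 * 2 ^ k).
Proof.
elim: k => [|k [b Zb e]].
  have [a Za ea] := U_P_odd r; have [b Zb eb] := U_gz_in_Zz Za; have [c Zc ec] := U_wz_in_Zz Zb.
  have e : U (U (P ^+ r.*2.+1)) = w + w * z * b *+ 8.
    by rewrite ea mulrDr mulr1 mulrnAr mulrA raddfD raddfMn /= U_g eb; ring.
  exists (c *+ 2 - b); first by in_Zz.
  by rewrite /= e raddfD raddfMn /= U_w ec; ring.
have [c Zc ec] := U_wz_in_Zz Zb.
exists (2 + z *+ 10 + z ^+ 2 *+ 8 + c); first by in_Zz.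
transitivity (U (iter k.+3 U (P ^+ r.*2.+1) - iter k.+2 U (P ^+ r.*2.+1))).
  by rewrite raddfB.
rewrite e.
have -> : w * z * (1 + b *+ 2) = w * z + w * z * b *+ 2 by ring.
rewrite raddfMn expnS mulnCA [RHS]mulrnA; congr (_ *+ _).
by rewrite raddfD raddfMn /= U_wz ec; ring.
Qed.

(** * Reduction modulo 2 *)

Definition eqmod2 (f h : fps int) := exists u, f = h + u *+ 2.

Lemma eqmod2_refl f : eqmod2 f f.
Proof. by exists 0; rewrite mul0rn addr0. Qed.

Lemma eqmod2_sym f h : eqmod2 f h -> eqmod2 h f.
Proof. by move=> [u ->]; exists (- u); ring. Qed.

Lemma eqmod2M f f' h h' : eqmod2 f f' -> eqmod2 h h' -> eqmod2 (f * h) (f' * h').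
Proof. by move=> [u ->] [u' ->]; exists (f' * u' + u * h' + u * u' *+ 2); ring. Qed.

Lemma eqmod2M1 f h : eqmod2 f 1 -> eqmod2 h 1 -> eqmod2 (f * h) 1.
Proof. by move=> f1 h1; rewrite -[1]mulr1; apply: eqmod2M. Qed.

Lemma eqmod2_sq1 f : eqmod2 f 1 -> eqmod2 (sq f) 1.
Proof. by move=> [u ->]; exists (sq u); rewrite rmorphD rmorphMn rmorph1. Qed.

Lemma phi_mod2 : eqmod2 phi 1.
Proof.
exists (Fps (fun n => ((n != 0) && is_square n)%:R)); apply: fpsP => n.
by rewrite coefsD coefsMn coefs1 /=; case: n => [|n]; rewrite ?mul0rn ?addr0 ?add0r.
Qed.

Lemma v_mod2 : eqmod2 v 1.
Proof.
apply: eqmod2_sym; rewrite -neg_phiV -[X in eqmod2 _ X]mul1r.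
apply: eqmod2M; last exact: eqmod2_refl.
by have [u ->] := phi_mod2; exists (neg u); rewrite rmorphD rmorphMn rmorph1.
Qed.

Lemma P_mod2 : eqmod2 P 1.
Proof. by apply: eqmod2M1; [exact: phi_mod2 | apply: eqmod2_sq1; exact: v_mod2]. Qed.

Lemma w_mod2 : eqmod2 w 1.
Proof.
have P1 := P_mod2; have p1 := eqmod2_sq1 P1.
by rewrite /w gE !expr2; do ![apply: eqmod2M1 => //].
Qed.

(** Modulo 2 the factors phi(q^4) and 1 / phi(-q)^2 become 1, because phi does. *)
Lemma x_mod2 : eqmod2 x psi.
Proof.
rewrite /x -[psi in eqmod2 _ psi]mulr1; apply: eqmod2M; last first.
  by rewrite expr2; apply: eqmod2M1; exact: v_mod2.
rewrite -[psi in eqmod2 _ psi]mul1r; apply: eqmod2M; last exact: eqmod2_refl.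
by do 2!apply: eqmod2_sq1; exact: phi_mod2.
Qed.

Lemma OPT_sub m i n : odd m -> (3 <= i)%N -> exists c : int,
  (OPT m (2 ^ i * n))%:Z - (OPT m (2 ^ (i - 1) * n))%:Z =
    (2 ^ (i + 1))%N%:Z * ((odd n && is_square n)%:Z + 2 * c).
Proof.
move=> m_odd i3; have -> : m = m./2.*2.+1 by rewrite -{1}(odd_double_half m) m_odd.
have -> : i = (i - 3).+3 by lia.
set r := m./2; set k := (i - 3)%N; rewrite subn1 /=.
have [b _ e] := iter_U_P_sub r k.
have [u eu] : eqmod2 (w * x * (1 + b *+ 2)) psi.
  rewrite -[psi in eqmod2 _ psi]mul1r -[1 * psi]mulr1; apply: eqmod2M; last by exists b.
  exact: eqmod2M w_mod2 x_mod2.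
exists (coefs u n).
rewrite -!natz !OPT_coefs_P -!coefs_iterU -coefsN -coefsD e.
(* Replacing z by 4x supplies the last factor 4, and 16 times 2^k is 2^(i+1) for i = k + 3. *)
have -> : w * z * (1 + b *+ 2) *+ (4 * 2 ^ k) = (w * x * (1 + b *+ 2)) *+ (2 ^ (k.+3 + 1)).
  rewrite (_ : 2 ^ (k.+3 + 1) = 4 * (4 * 2 ^ k))%N; last by rewrite addn1 !expnS; lia.
  by rewrite [RHS]mulrnA /z; congr (_ *+ _); ring.
rewrite eu coefsMn coefsD coefsMn -[LHS]mulr_natl -[coefs u n *+ 2]mulr_natl.
by rewrite -[coefs psi n]/((odd n && is_square n)%:R) !natz.
Qed.

End EvenPartIteration.

Theorem corollary1p2 (m i n : nat) (hm1 : (1 <= m)%N) (hm : odd m)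
    (hi : (3 <= i)%N) (hn : (1 <= n)%N) :
  (OPT m (2 ^ i * n) = OPT m (2 ^ (i - 1) * n) %[mod 2 ^ (i + 1)])%N /\
  ((odd n /\ exists k : nat, n = (k ^ 2)%N) ->
     nu ((OPT m (2 ^ i * n))%:Z - (OPT m (2 ^ (i - 1) * n))%:Z)%R
       = ((i + 1)%N%:Z%:E)%E) /\
  (~ (odd n /\ exists k : nat, n = (k ^ 2)%N) ->
     ((i + 2)%N%:Z%:E <=
        nu ((OPT m (2 ^ i * n))%:Z - (OPT m (2 ^ (i - 1) * n))%:Z)%R)%E).
Proof.
have [c e] := OPT_sub n hm hi; rewrite e; split; last split.
- apply/eqP; have : (OPT m (2 ^ i * n) == OPT m (2 ^ (i - 1) * n) %[mod (2 ^ (i + 1))%N])%Z.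
    by rewrite eqz_mod_dvd e dvdz_mulr ?dvdzz.
  by rewrite !modz_nat.
- case=> n_odd /is_squareP n_sq; rewrite n_odd n_sq /nu.
  (* [1 + 2 * c] is odd: nonzero, and without contribution to the valuation. *)
  have c0 : (1 + 2 * c != 0)%R by lia.
  rewrite mulf_eq0 (negbTE c0) orbF eqz_nat expn_eq0 /=.
  rewrite abszM lognM ?expn_gt0 ?absz_gt0 // pfactorK // lognE.
  by rewrite (_ : (2 %| _)%N = false) ?andbF ?addn0 //; lia.
- move=> nsq; have -> : odd n && is_square n = false.
    by apply/negP => /andP[n_odd /is_squareP n_sq]; case: nsq.
  (* A zero difference has infinite valuation; otherwise the factor 2 of [2 * c] raises i + 1 to at
     least i + 2. *)
  rewrite /nu add0r; case: eqP => [_|/eqP c0]; first exact: leey.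
  rewrite lee_fin lez_nat abszM abszM lognM ?expn_gt0 //; last first.
    by rewrite -abszM absz_gt0; apply: contraNneq c0 => ->; rewrite mulr0.
  rewrite pfactorK // lognM //.
    by rewrite -addnA leq_add2l leq_addr.
  by rewrite absz_gt0; apply: contraNneq c0 => ->; rewrite !mulr0.
Qed.
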